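(* For each iteration $k<k_t$ of the gGKB process applied to $(A,b,B)$, with $\mathcal{S}_k=\mathrm{span}\{z_1,\dots,z_k\}$, there exists a unique solution $x_k$ to the problem $$x_k=\arg\min_{x\in\mathcal{X}_k}\|x\|_{C_{rkhs}},\qquad \mathcal{X}_k=\Big\{x\in\mathcal{S}_k:\ \|Ax-b\|_2=\min_{x'\in\mathcal{S}_k}\|Ax'-b\|_2\Big\}.$$ Furthermore, there exists a unique solution to $\min_{x\in\mathcal{S}_k}\|Ax-b\|_2$.
   Context: Let $A\in\mathbb{R}^{m\times n}$, $b\in\mathbb{R}^m$, and let $B\in\mathbb{R}^{n\times n}$ be symmetric positive definite. $\dagger$ denotes the Moore-Penrose pseudo-inverse. Let $V\in\mathbb{R}^{n\times n}$ and $\Lambda=\mathrm{diag}(\lambda_1,\dots,\lambda_n)$ satisfy $A^\top AV=BV\Lambda$, $V^\top BV=I_n$. Set $C_{rkhs}=(V\Lambda V^\top)^\dagger$, so that $C_{rkhs}^\dagger=V\Lambda V^\top=B^{-1}A^\top AB^{-1}$. Write $\langle x,y\rangle_{C_{rkhs}}=x^\top C_{rkhs}y$ and $\|x\|_{C_{rkhs}}=\langle x,x\rangle_{C_{rkhs}}^{1/2}$ (a semi-norm on $\mathbb{R}^n$). The generalized Golub-Kahan bidiagonalization (gGKB) generates vectors $u_i\in\mathbb{R}^m$, $z_i\in\mathbb{R}^n$ and scalars $\alpha_i,\beta_i\ge 0$ by $$\beta_1u_1=b,\qquad \alpha_1z_1=C_{rkhs}^\dagger A^\top u_1,$$ $$\beta_{i+1}u_{i+1}=Az_i-\alpha_iu_i,\qquad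 \alpha_{i+1}z_{i+1}=C_{rkhs}^\dagger A^\top u_{i+1}-\beta_{i+1}z_i\qquad(i\ge1),$$ where $\beta_i$ is the Euclidean norm and $\alpha_i$ the $\|\cdot\|_{C_{rkhs}}$-semi-norm of the respective right-hand side, so that $\|u_i\|_2=\|z_i\|_{C_{rkhs}}=1$. The process stops as soon as some $\alpha_i$ or $\beta_i$ is zero. The termination step is $k_t=\max_{k\ge1}\{\alpha_k\beta_k>0\}$, i.e. the largest $k\ge 1$ with $\alpha_k\beta_k>0$. *)

(* Defs.v *)
From HB Require Import structures.
From mathcomp Require Import all_boot all_order all_algebra.
From mathcomp Require Import reals.

Set Implicit Arguments.
Unset Strict Implicit.
Unset Printing Implicit Defensive.

Import Order.TTheory GRing.Theory Num.Theory.

Local Open Scope ring_scope.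

Definition posdefmx (R : realFieldType) (n : nat) (B : 'M[R]_n) : Prop :=
  B^T = B /\ forall x : 'cV[R]_n, x != 0 -> 0 < (x^T *m B *m x) 0 0.

Definition penrose (R : realFieldType) (m n : nat)
    (M : 'M[R]_(m, n)) (X : 'M[R]_(n, m)) : bool :=
  [&& M *m X *m M == M, X *m M *m X == X,
      (M *m X)^T == M *m X & (X *m M)^T == X *m M].

Lemma gram_unitmx (R : realFieldType) (r n : nat) (K : 'M[R]_(r, n)) :
  row_free K -> K *m K^T \in unitmx.
Proof.
move=> Kfree; rewrite -row_free_unit; apply: inj_row_free => v vKK0.
have vK0 : v *m K = 0.
  have : ((v *m K) *m (v *m K)^T) 0 0 = 0.
    by rewrite trmx_mul !mulmxA -(mulmxA v) vKK0 mul0mx mxE.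
  rewrite mxE => sq0; apply/rowP => j; rewrite [RHS]mxE; apply/eqP.
  rewrite -sqrf_eq0 expr2; move/eqP: sq0; rewrite psumr_eq0 => [|i _].
    by move=> /allP/(_ j (mem_index_enum j)); rewrite /= [(_^T) _ _]mxE.
  by rewrite [(_^T) _ _]mxE -expr2 sqr_ge0.
by apply: (row_free_inj Kfree); rewrite vK0 mul0mx.
Qed.

Lemma penrose_exists (R : realFieldType) (m n : nat) (M : 'M[R]_(m, n)) :
  exists X, penrose M X.
Proof.
have [r [L [K [defM Ku Lu]]]] : exists r (L : 'M[R]_(m, r)) (K : 'M_(r, n)),
    [/\ M = L *m K, K *m K^T \in unitmx & L^T *m L \in unitmx].
  exists (\rank M), (col_base M), (row_base M); split.
  - by rewrite mulmx_base.
  - exact/gram_unitmx/row_base_free.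
  - rewrite -{2}[col_base M]trmxK; apply: gram_unitmx.
    by rewrite /row_free mxrank_tr; exact: col_base_full.
pose P := invmx (K *m K^T); pose Q := invmx (L^T *m L).
have KP : K *m K^T *m P = 1%:M by rewrite mulmxV.
have QL : Q *m (L^T *m L) = 1%:M by rewrite mulVmx.
pose X := K^T *m P *m (Q *m L^T).
have MX : M *m X = L *m Q *m L^T.
  by rewrite defM /X !mulmxA -(mulmxA L) -(mulmxA L) KP mulmx1.
have XM : X *m M = K^T *m P *m K.
  by rewrite defM /X -!mulmxA (mulmxA L^T) (mulmxA Q) QL mul1mx.
exists X; apply/and4P; split; apply/eqP.
- by rewrite MX defM -!mulmxA (mulmxA L^T) (mulmxA Q) QL mul1mx.
- by rewrite XM /X !mulmxA -(mulmxA (K^T *m P)) -(mulmxA (K^T *m P)) KP mulmx1.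
- by rewrite MX !trmx_mul trmxK trmx_inv trmx_mul trmxK mulmxA.
- by rewrite XM !trmx_mul trmxK trmx_inv trmx_mul trmxK mulmxA.
Qed.

Lemma penrose_uniq (R : realFieldType) (m n : nat) (M : 'M[R]_(m, n)) X Y :
  penrose M X -> penrose M Y -> X = Y.
Proof.
move=> /and4P[/eqP X1 /eqP X2 /eqP X3 /eqP X4].
move=> /and4P[/eqP Y1 /eqP Y2 /eqP Y3 /eqP Y4].
have MXY : M *m X = M *m Y.
  have: (M *m Y *m (M *m X))^T = (M *m X)^T by rewrite mulmxA Y1.
  by rewrite trmx_mul X3 Y3 mulmxA X1 => ->.
have XMY : X *m M = Y *m M.
  have: (X *m M *m (Y *m M))^T = (X *m M)^T
    by rewrite mulmxA -!mulmxA (mulmxA M) Y1.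
  by rewrite trmx_mul X4 Y4 -mulmxA (mulmxA M) X1 => ->.
by rewrite -X2 XMY -mulmxA MXY mulmxA Y2.
Qed.

Definition mppinv (R : realFieldType) (m n : nat) (M : 'M[R]_(m, n)) :
  'M[R]_(n, m) := xchoose (penrose_exists M).

Lemma mppinvP (R : realFieldType) (m n : nat) (M : 'M[R]_(m, n)) X :
  penrose M X <-> X = mppinv M.
Proof.
have pM := xchooseP (penrose_exists M).
by split=> [pX | ->//]; exact: penrose_uniq pX pM.
Qed.

Definition norm2 (R : rcfType) (m : nat) (x : 'cV[R]_m) : R :=
  Num.sqrt ((x^T *m x) 0 0).

Definition seminorm (R : rcfType) (n : nat) (C : 'M[R]_n) (x : 'cV[R]_n) : R :=
  Num.sqrt ((x^T *m C *m x) 0 0).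

Definition Crkhs (R : realFieldType) (n : nat)
    (V : 'M[R]_n) (lam : 'rV[R]_n) : 'M[R]_n :=
  mppinv (V *m diag_mx lam *m V^T).

Record gGKB_state (R : Type) (m n : nat) := GGKBState {
  st_beta : R; st_u : 'cV[R]_m; st_alpha : R; st_z : 'cV[R]_n }.

(* Since [0^-1 = 0], a vanishing [beta] (resp. [alpha]) produces a zero [u]
   (resp. [z]), after which all the scalars are zero (see [gGKB_stop] below):
   running the recurrence past the stopping point adds no index with
   [alpha * beta > 0]. *)
Definition gGKB_first (R : rcfType) (m n : nat) (A : 'M[R]_(m, n))
    (b : 'cV[R]_m) (C : 'M[R]_n) : gGKB_state R m n :=
  let beta := norm2 b in
  let u := beta^-1 *: b in
  let s := mppinv C *m A^T *m u in
  let alpha := seminorm C s in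
  GGKBState beta u alpha (alpha^-1 *: s).

Definition gGKB_next (R : rcfType) (m n : nat) (A : 'M[R]_(m, n))
    (C : 'M[R]_n) (st : gGKB_state R m n) : gGKB_state R m n :=
  let r := A *m st_z st - st_alpha st *: st_u st in
  let beta := norm2 r in
  let u := beta^-1 *: r in
  let s := mppinv C *m A^T *m u - beta *: st_z st in
  let alpha := seminorm C s in
  GGKBState beta u alpha (alpha^-1 *: s).

(* Indices start at 1; the value at index 0 is junk. *)
Definition gGKB (R : rcfType) (m n : nat) (A : 'M[R]_(m, n)) (b : 'cV[R]_m)
    (C : 'M[R]_n) (i : nat) : gGKB_state R m n :=
  iter i.-1 (gGKB_next A C) (gGKB_first A b C).

Definition gGKB_beta (R : rcfType) (m n : nat) (A : 'M[R]_(m, n))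
  (b : 'cV[R]_m) (C : 'M[R]_n) (i : nat) : R := st_beta (gGKB A b C i).
Definition gGKB_alpha (R : rcfType) (m n : nat) (A : 'M[R]_(m, n))
  (b : 'cV[R]_m) (C : 'M[R]_n) (i : nat) : R := st_alpha (gGKB A b C i).
Definition gGKB_z (R : rcfType) (m n : nat) (A : 'M[R]_(m, n))
  (b : 'cV[R]_m) (C : 'M[R]_n) (i : nat) : 'cV[R]_n := st_z (gGKB A b C i).

Lemma gGKB_stop (R : rcfType) (m n : nat) (A : 'M[R]_(m, n)) (b : 'cV[R]_m)
    (C : 'M[R]_n) (i j : nat) :
  (0 < i)%N -> (i < j)%N -> gGKB_alpha A b C i * gGKB_beta A b C i = 0 ->
  gGKB_alpha A b C j = 0 /\ gGKB_beta A b C j = 0.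
Proof.
have normE st : st_z st = 0 -> st_alpha st *: st_u st = 0 ->
    gGKB_next A C st = GGKBState 0 0 0 0.
  have n0 : norm2 (0 : 'cV[R]_m) = 0 by rewrite /norm2 mulmx0 mxE sqrtr0.
  have s0 : seminorm C 0 = 0 by rewrite /seminorm mulmx0 mxE sqrtr0.
  move=> z0 au0; rewrite /gGKB_next z0 au0 mulmx0 subrr n0 !scaler0 mulmx0.
  by rewrite subrr s0 scaler0.
case: i j => // i [//|j] _; rewrite ltnS /gGKB_alpha /gGKB_beta /gGKB /= => ij.
set st := iter i _ _ => /eqP; rewrite mulf_eq0 => ab0.
have [z0 au0] : st_z st = 0 /\ st_alpha st *: st_u st = 0.
  case/orP: ab0; rewrite {}/st.
    case: i {ij} => [|i] /= /eqP; rewrite /gGKB_first /gGKB_next /= => ->;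
      by rewrite invr0 !scale0r.
  case: i {ij} => [|i] /=.
    rewrite /gGKB_first /= => /eqP->; rewrite invr0 scale0r scaler0 mulmx0.
    by rewrite scaler0.
  rewrite /gGKB_next /= => /eqP->.
  by rewrite invr0 !scale0r mulmx0 subrr scaler0 scaler0.
have -> : j = ((j - i.+1).+1 + i)%N by rewrite addSn -addnS subnK.
rewrite iterD -/st.
suff -> : iter (j - i.+1).+1 (gGKB_next A C) st = GGKBState 0 0 0 0 by [].
elim: (j - i.+1)%N => [|k IHk]; first by rewrite /= normE.
by rewrite iterS IHk normE //= scale0r.
Qed.

Definition is_termination_step (R : rcfType) (m n : nat) (A : 'M[R]_(m, n))
    (b : 'cV[R]_m) (C : 'M[R]_n) (kt : nat) : Prop :=
  [/\ (1 <= kt)%N, 0 < gGKB_alpha A b C kt * gGKB_beta A b C kt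
    & forall k, (1 <= k)%N -> 0 < gGKB_alpha A b C k * gGKB_beta A b C k ->
        (k <= kt)%N].

Definition gGKB_space (R : rcfType) (m n : nat) (A : 'M[R]_(m, n))
    (b : 'cV[R]_m) (C : 'M[R]_n) (k : nat) : {vspace 'cV[R]_n} :=
  span [seq gGKB_z A b C i | i <- iota 1 k].

Definition is_argmin (T : Type) (R : realFieldType) (P : T -> Prop)
    (f : T -> R) (x : T) : Prop :=
  P x /\ forall y, P y -> f x <= f y.

(* Main.v *)
Require Import Defs.
From mathcomp Require Import all_boot all_order all_algebra.
From mathcomp Require Import reals.

(** The point is that [A] is injective on every space [S_k], so that the
    least-squares problem over [S_k] has exactly one solution; the set [X_k] is
    then a singleton and minimizing the semi-norm over it is immediate.

    For the injectivity, the pseudo-inverse of [C] is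
    [V Lambda V^T = (V V^T A^T) (A V V^T)], because [Lambda = (A V)^T (A V)].
    The recurrence multiplies by this matrix to produce each new vector, and
    otherwise only scales and adds previous ones, so every [z_i], hence all of
    [S_k], lies in the range of [V V^T A^T].  If [x = V V^T A^T y] and
    [A x = 0], then [0 = y^T A x] is the squared norm of [V^T A^T y], so this
    vector vanishes and [x] with it.

    Existence and uniqueness of the least-squares solution come from the normal
    equations in a basis of [S_k]: their matrix is a Gram matrix of independent
    vectors, and the Pythagorean identity shows that a residual orthogonal to
    [A S_k] is strictly shorter than any other one. *)

Set Implicit Arguments.
Unset Strict Implicit.
Unset Printing Implicit Defensive.

Import Order.TTheory GRing.Theory Num.Theory.

Local Open Scope ring_scope.

Lemma dotmx_ge0 (R : realFieldType) (m : nat) (x : 'cV[R]_m) :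
  0 <= (x^T *m x) 0 0.
Proof.
by rewrite mxE; apply: sumr_ge0 => i _; rewrite mxE -expr2 sqr_ge0.
Qed.

Lemma dotmx_eq0 (R : realFieldType) (m : nat) (x : 'cV[R]_m) :
  (x^T *m x) 0 0 = 0 -> x = 0.
Proof.
rewrite mxE => /eqP; rewrite psumr_eq0 => [/allP sq0|i _]; last first.
  by rewrite mxE -expr2 sqr_ge0.
apply/colP => i; rewrite [RHS]mxE; apply/eqP.
by have := sq0 i (mem_index_enum i); rewrite /= mxE -expr2 sqrf_eq0.
Qed.

Lemma norm2_le (R : rcfType) (m : nat) (x y : 'cV[R]_m) :
  (norm2 x <= norm2 y) = ((x^T *m x) 0 0 <= (y^T *m y) 0 0).
Proof. by rewrite /norm2 ler_sqrt // dotmx_ge0. Qed.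

(** Coordinates turn the problem over [S] into one without constraint: the
    columns of [Z] are a basis of [S], so injectivity of [A] on [S] says that
    [A Z] has independent columns and its Gram matrix can be inverted. *)
Lemma normal_equations_solvable (R : realFieldType) (m n : nat)
    (A : 'M[R]_(m, n)) (b : 'cV[R]_m) (S : {vspace 'cV[R]_n}) :
  (forall x, x \in S -> A *m x = 0 -> x = 0) ->
  exists2 x, x \in S & forall d, d \in S -> (A *m d)^T *m (A *m x - b) = 0.
Proof.
move=> Ainj.
pose Z : 'M[R]_(n, \dim S) := \matrix_(i, j) (vbasis S)`_j i 0.
have Zsum c : Z *m c = \sum_j c j 0 *: (vbasis S)`_j.
  apply/colP => i; rewrite mxE summxE; apply: eq_bigr => j _.
  by rewrite !mxE mulrC.
have ZS c : Z *m c \in S.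
  rewrite Zsum; apply: memv_suml => j _; apply/memvZ/vbasis_mem/mem_nth.
  by rewrite size_tuple.
have Zsurj x : x \in S -> exists c, x = Z *m c.
  move=> xS; exists (\col_j coord (vbasis S) j x).
  rewrite {1}(coord_vbasis xS) Zsum.
  by apply: eq_bigr => j _; rewrite mxE.
have Zinj (c : 'cV_(\dim S)) : Z *m c = 0 -> c = 0.
  rewrite Zsum => Zc0.
  have /freeP/(_ (fun j => c j 0) Zc0) c0 := basis_free (vbasisP S).
  by apply/colP => j; rewrite c0 mxE.
have AZfree : row_free (A *m Z)^T.
  apply: inj_row_free => v /(congr1 trmx); rewrite trmx_mul trmxK trmx0.
  rewrite -mulmxA => /(Ainj _ (ZS _))/Zinj/(congr1 trmx).
  by rewrite trmxK trmx0.
have := gram_unitmx AZfree; rewrite trmxK; set AZ := A *m Z => AZu.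
exists (Z *m (invmx (AZ^T *m AZ) *m (AZ^T *m b))) => // _ /Zsurj[c ->].
rewrite !(mulmxA A) -/AZ trmx_mul -mulmxA mulmxBr (mulmxA AZ^T AZ).
by rewrite mulKVmx // subrr mulmx0.
Qed.

Lemma least_squares_uniq (R : rcfType) (m n : nat)
    (A : 'M[R]_(m, n)) (b : 'cV[R]_m) (S : {vspace 'cV[R]_n}) :
  (forall x, x \in S -> A *m x = 0 -> x = 0) ->
  exists! x, is_argmin (fun x => x \in S) (fun x => norm2 (A *m x - b)) x.
Proof.
move=> Ainj; have [x xS orth] := normal_equations_solvable b Ainj.
have pythagoras y : y \in S ->
    ((A *m y - b)^T *m (A *m y - b)) 0 0 =
    ((A *m x - b)^T *m (A *m x - b)) 0 0 +
    ((A *m (y - x))^T *m (A *m (y - x))) 0 0.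
  move=> yS; have o1 := orth _ (memvB yS xS).
  have o2 : (A *m x - b)^T *m (A *m (y - x)) = 0.
    by rewrite -[LHS]trmxK trmx_mul trmxK o1 trmx0.
  have -> : A *m y - b = A *m x - b + A *m (y - x).
    by rewrite mulmxBr [RHS]addrC addrA subrK.
  move: o1 o2; set e := A *m (y - x) => o1 o2.
  rewrite [(_ + _)^T]raddfD /= mulmxDl 2!(mulmxDr _ _ e) o1 o2 addr0 add0r.
  by rewrite [LHS]mxE.
exists x; split.
  split=> // y yS; rewrite norm2_le (pythagoras y yS) lerDl; exact: dotmx_ge0.
move=> y [yS /(_ x xS)]; rewrite norm2_le (pythagoras y yS) gerDl => le0.
apply/esym/eqP; rewrite -subr_eq0; apply/eqP; apply: Ainj; first exact: memvB.
by apply: dotmx_eq0; apply/eqP; rewrite eq_le le0 dotmx_ge0.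
Qed.

Lemma argmin_over_unique (T : Type) (R : realFieldType) (P : T -> Prop)
    (f : T -> R) :
  (exists! x, P x) -> exists! x, is_argmin P f x.
Proof.
case=> x [Px uniq_x]; exists x; split; last by move=> y [/uniq_x].
by split=> // y /uniq_x <-.
Qed.

(** The four Penrose conditions are symmetric in the two matrices. *)
Lemma mppinvK (R : realFieldType) (m n : nat) (M : 'M[R]_(m, n)) :
  mppinv (mppinv M) = M.
Proof.
apply/esym/mppinvP.
have /mppinvP/and4P[M1 M2 M3 M4] := erefl (mppinv M).
exact/and4P.
Qed.

(** When the process breaks down the normalization divides by zero and returns
    the zero vector, which is in the range as well, so every index is covered. *)
Lemma gGKB_z_range (R : rcfType) (m n : nat) (A : 'M[R]_(m, n))
    (b : 'cV[R]_m) (C : 'M[R]_n) (i : nat) :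
  gGKB_z A b C i \in limg (linfun (mulmx (mppinv C) : 'cV_n -> 'cV_n)).
Proof.
have inM (w : 'cV_n) : mppinv C *m w \in limg (linfun (mulmx (mppinv C))).
  by apply/memv_imgP; exists w; rewrite ?memvf ?lfunE.
rewrite /gGKB_z /gGKB; elim: i.-1 => [|j IHj] /=.
  by apply: memvZ; rewrite -mulmxA inM.
by apply/memvZ/memvB; [rewrite -mulmxA inM | apply: memvZ].
Qed.

Lemma gGKB_space_range (R : rcfType) (m n : nat) (A : 'M[R]_(m, n))
    (b : 'cV[R]_m) (C : 'M[R]_n) (k : nat) (x : 'cV[R]_n) :
  x \in gGKB_space A b C k -> exists w, x = mppinv C *m w.
Proof.
have /subvP sub : (gGKB_space A b C k <=
    limg (linfun (mulmx (mppinv C) : 'cV_n -> 'cV_n)))%VS.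
  by apply/span_subvP => _ /mapP[i _ ->]; exact: gGKB_z_range.
by case/sub/memv_imgP => w _ ->; exists w; rewrite lfunE.
Qed.

(** Pairing [A x] with [y] gives the squared norm of [W^T A^T y]. *)
Lemma mulmx_inj_gram_range (R : realFieldType) (m n p : nat)
    (A : 'M[R]_(m, n)) (W : 'M[R]_(n, p)) (y : 'cV[R]_m) :
  A *m (W *m W^T *m A^T *m y) = 0 -> W *m W^T *m A^T *m y = 0.
Proof.
move=> Ax0; suff t0 : W^T *m A^T *m y = 0.
  by rewrite -!mulmxA (mulmxA W^T) t0 mulmx0.
apply: dotmx_eq0; rewrite !trmx_mul !trmxK.
have -> : y^T *m (A *m W) *m (W^T *m A^T *m y) =
    y^T *m (A *m (W *m W^T *m A^T *m y)) by rewrite !mulmxA.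
by rewrite Ax0 mulmx0 mxE.
Qed.

(** By the generalized eigenvalue equations, [Lambda = V^T A^T A V]. *)
Lemma eigen_decomposition_gram (R : realFieldType) (m n : nat)
    (A : 'M[R]_(m, n)) (B V : 'M[R]_n) (lam : 'rV[R]_n) :
  A^T *m A *m V = B *m V *m diag_mx lam -> V^T *m B *m V = 1%:M ->
  V *m diag_mx lam *m V^T = V *m V^T *m A^T *m (A *m V *m V^T).
Proof.
move=> hV hVB; have -> : diag_mx lam = V^T *m (A^T *m A *m V).
  by rewrite hV !mulmxA hVB mul1mx.
by rewrite !mulmxA.
Qed.

Lemma mulmx_inj_gGKB_space (R : rcfType) (m n : nat)
    (A : 'M[R]_(m, n)) (b : 'cV[R]_m) (B V : 'M[R]_n) (lam : 'rV[R]_n)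
    (k : nat) (x : 'cV[R]_n) :
  A^T *m A *m V = B *m V *m diag_mx lam -> V^T *m B *m V = 1%:M ->
  x \in gGKB_space A b (Crkhs V lam) k -> A *m x = 0 -> x = 0.
Proof.
move=> hV hVB /gGKB_space_range[w ->].
rewrite mppinvK (eigen_decomposition_gram hV hVB).
by rewrite -(mulmxA _ _ w); exact: mulmx_inj_gram_range.
Qed.

Theorem theorem4p7 (R : realType) (m n : nat)
    (A : 'M[R]_(m, n)) (b : 'cV[R]_m) (B : 'M[R]_n) (hB : posdefmx B)
    (V : 'M[R]_n) (lam : 'rV[R]_n)
    (hV : A^T *m A *m V = B *m V *m diag_mx lam)
    (hVB : V^T *m B *m V = 1%:M)
    (kt : nat) (hkt : is_termination_step A b (Crkhs V lam) kt)
    (k : nat) (hk1 : (1 <= k)%N) (hk : (k < kt)%N) :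
  let C := Crkhs V lam in
  let inS := fun x : 'cV[R]_n => x \in gGKB_space A b C k in
  let residual := fun x : 'cV[R]_n => norm2 (A *m x - b) in
  let inX := is_argmin inS residual in
  (exists! x : 'cV[R]_n, is_argmin inX (seminorm C) x) /\
  (exists! x : 'cV[R]_n, is_argmin inS residual x).
Proof.
move=> C inS residual inX.
have LS : exists! x, inX x.
  apply: least_squares_uniq => x.
  exact: mulmx_inj_gGKB_space hV hVB.
by split; first exact: argmin_over_unique.
Qed.
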